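(* Let $\mathcal C$ be a semi-abelian category in which every composite of two normal monomorphisms is a normal monomorphism. Then: (1) for every object $B$, the kernel functor $\mathrm{Ker}_B\colon\mathsf{Pt}_B(\mathcal C)\to\mathcal C$ preserves normal closures; (2) $\mathcal C$ is strongly protomodular; (3) $\mathcal C$ satisfies (SH); (4) $\mathcal C$ satisfies (NH).
   Context: Semi-abelian category: pointed, Barr-exact, protomodular, with binary coproducts. Normal monomorphism = kernel; the normal closure of a subobject $X\le A$ is the smallest normal subobject of $A$ containing $X$. $\mathsf{Pt}_B(\mathcal C)$: points $(A,\alpha,\beta)$ with $\alpha\beta=1_B$, morphisms commuting with $\alpha$ and $\beta$; $\mathrm{Ker}_B(A,\alpha,\beta)=\mathrm{Ker}\alpha$. Strong protomodularity (in this exact context): every kernel functor $\mathrm{Ker}_B$ reflects normal monomorphisms. (SH): for equivalence relations $R,S$ on a common object $A$, if their normalisations $N_R=r_2\circ\ker(r_1)$, $N_S$ Huq-commute (there is $\varphi\colon N_R\times N_S\to A$ restricting to the two inclusions), then $R,S$ admit a connector, i.e. a morphism $p\colon R\times_A S\to A$ (pullback of $r_2$ and $s_1$) with $p(a,b,b)=a$, $p(a,a,b)=b$. (NH): the Higgins commutator of two normal subobjects of $A$ is normal in $A$, where the Higgins commutator $[X,Y]$ of $x\colon X\rightarrowtail A$, $y\colon Y\rightarrowtail A$ is the regular image under $\langle x,y\rangle$ of $\mathrm{Ker}\bigl(\begin{smallmatrix}1_X&0\\0&1_Y\end{smallmatrix}\colon X+Y\to X\times Y\bigr)$. *)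

(* Defs.v *)
From Stdlib Require Import ProofIrrelevance.

Set Implicit Arguments.

Record Category := {
  Ob :> Type;
  Hom : Ob -> Ob -> Type;
  idm : forall A, Hom A A;
  comp : forall A B C, Hom B C -> Hom A B -> Hom A C;
  comp_assoc : forall A B C D (h : Hom C D) (g : Hom B C) (f : Hom A B),
      comp h (comp g f) = comp (comp h g) f;
  id_left : forall A B (f : Hom A B), comp (idm B) f = f;
  id_right : forall A B (f : Hom A B), comp f (idm A) = f }.

Arguments Hom {c} _ _.
Arguments idm {c} _.
Arguments comp {c} {A B C} _ _.

Declare Scope cat_scope.
Delimit Scope cat_scope with cat.
Notation "g ∘ f" := (comp g f) (at level 40, left associativity) : cat_scope.
Open Scope cat_scope.

Section Basic.
Variable C : Category.

Definition is_mono {A B : C} (m : Hom A B) : Prop :=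
  forall W (u v : Hom W A), m ∘ u = m ∘ v -> u = v.

Definition is_iso {A B : C} (f : Hom A B) : Prop :=
  exists g : Hom B A, g ∘ f = idm A /\ f ∘ g = idm B.

Definition is_initial (Z : C) : Prop :=
  forall X : C, exists f : Hom Z X, forall g : Hom Z X, g = f.
Definition is_terminal (Z : C) : Prop :=
  forall X : C, exists f : Hom X Z, forall g : Hom X Z, g = f.
Definition is_zero_object (Z : C) : Prop := is_initial Z /\ is_terminal Z.

Definition pointed : Prop := exists Z : C, is_zero_object Z.

Definition is_zero_map {A B : C} (f : Hom A B) : Prop :=
  exists (Z : C) (a : Hom A Z) (b : Hom Z B), is_zero_object Z /\ f = b ∘ a.

Definition is_kernel {K A B : C} (k : Hom K A) (f : Hom A B) : Prop :=
  is_zero_map (f ∘ k) /\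
  forall (W : C) (g : Hom W A), is_zero_map (f ∘ g) ->
    exists u : Hom W K, k ∘ u = g /\ forall v : Hom W K, k ∘ v = g -> v = u.

Definition is_normal_mono {N A : C} (n : Hom N A) : Prop :=
  exists (B : C) (f : Hom A B), is_kernel n f.

Definition factors_through {X N A : C} (x : Hom X A) (n : Hom N A) : Prop :=
  exists u : Hom X N, n ∘ u = x.

Definition is_normal_closure {N X A : C} (n : Hom N A) (x : Hom X A) : Prop :=
  is_normal_mono n /\ factors_through x n /\
  forall (N' : C) (n' : Hom N' A), is_normal_mono n' -> factors_through x n' ->
    factors_through n n'.

Definition is_pullback {P X Y Z : C} (p1 : Hom P X) (p2 : Hom P Y)
    (f : Hom X Z) (g : Hom Y Z) : Prop :=
  f ∘ p1 = g ∘ p2 /\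
  forall (W : C) (a : Hom W X) (b : Hom W Y), f ∘ a = g ∘ b ->
    exists u : Hom W P, (p1 ∘ u = a /\ p2 ∘ u = b) /\
      forall v : Hom W P, p1 ∘ v = a -> p2 ∘ v = b -> v = u.

Definition is_product {P X Y : C} (p1 : Hom P X) (p2 : Hom P Y) : Prop :=
  forall (W : C) (a : Hom W X) (b : Hom W Y),
    exists u : Hom W P, (p1 ∘ u = a /\ p2 ∘ u = b) /\
      forall v : Hom W P, p1 ∘ v = a -> p2 ∘ v = b -> v = u.

Definition is_coproduct {S X Y : C} (i1 : Hom X S) (i2 : Hom Y S) : Prop :=
  forall (W : C) (a : Hom X W) (b : Hom Y W),
    exists u : Hom S W, (u ∘ i1 = a /\ u ∘ i2 = b) /\
      forall v : Hom S W, v ∘ i1 = a -> v ∘ i2 = b -> v = u.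

Definition is_coequalizer {R A Q : C} (q : Hom A Q) (f g : Hom R A) : Prop :=
  q ∘ f = q ∘ g /\
  forall (W : C) (h : Hom A W), h ∘ f = h ∘ g ->
    exists u : Hom Q W, u ∘ q = h /\ forall v : Hom Q W, v ∘ q = h -> v = u.

Definition is_regular_epi {A Q : C} (q : Hom A Q) : Prop :=
  exists (R : C) (f g : Hom R A), is_coequalizer q f g.

Definition has_terminal : Prop := exists T : C, is_terminal T.
Definition has_pullbacks : Prop :=
  forall (X Y Z : C) (f : Hom X Z) (g : Hom Y Z),
    exists (P : C) (p1 : Hom P X) (p2 : Hom P Y), is_pullback p1 p2 f g.
Definition finitely_complete : Prop := has_terminal /\ has_pullbacks.
Definition has_binary_coproducts : Prop :=
  forall X Y : C, exists (S : C) (i1 : Hom X S) (i2 : Hom Y S), is_coproduct i1 i2.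

Definition regular : Prop :=
  finitely_complete /\
  (forall (A B : C) (f : Hom A B), exists (I : C) (e : Hom A I) (m : Hom I B),
      is_regular_epi e /\ is_mono m /\ f = m ∘ e) /\
  (forall (P X Y Z : C) (p1 : Hom P X) (p2 : Hom P Y) (f : Hom X Z) (g : Hom Y Z),
      is_pullback p1 p2 f g -> is_regular_epi g -> is_regular_epi p1).

Definition is_equivalence_relation {R A : C} (r1 r2 : Hom R A) : Prop :=
  (forall (W : C) (u v : Hom W R), r1 ∘ u = r1 ∘ v -> r2 ∘ u = r2 ∘ v -> u = v) /\
  (exists d : Hom A R, r1 ∘ d = idm A /\ r2 ∘ d = idm A) /\
  (exists s : Hom R R, r1 ∘ s = r2 /\ r2 ∘ s = r1) /\
  (forall (P : C) (p1 p2 : Hom P R), is_pullback p1 p2 r2 r1 ->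
     exists t : Hom P R, r1 ∘ t = r1 ∘ p1 /\ r2 ∘ t = r2 ∘ p2).

Definition exact : Prop :=
  regular /\
  forall (R A : C) (r1 r2 : Hom R A), is_equivalence_relation r1 r2 ->
    exists (Z : C) (f : Hom A Z), is_pullback r1 r2 f f.

End Basic.

Arguments is_mono {C A B} m.
Arguments is_iso {C A B} f.
Arguments is_zero_map {C A B} f.
Arguments is_kernel {C K A B} k f.
Arguments is_normal_mono {C N A} n.
Arguments factors_through {C X N A} x n.
Arguments is_normal_closure {C N X A} n x.
Arguments is_pullback {C P X Y Z} p1 p2 f g.
Arguments is_product {C P X Y} p1 p2.
Arguments is_coproduct {C S X Y} i1 i2.
Arguments is_coequalizer {C R A Q} q f g.
Arguments is_regular_epi {C A Q} q.
Arguments is_equivalence_relation {C R A} r1 r2.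

Section Points.
Variable C : Category.
Variable B : C.

Record point := Point {
  pt_ob : C;
  pt_alpha : Hom pt_ob B;
  pt_beta : Hom B pt_ob;
  pt_split : pt_alpha ∘ pt_beta = idm B }.

Record pt_hom (P Q : point) := PtHom {
  pt_map : Hom (pt_ob P) (pt_ob Q);
  pt_map_alpha : pt_alpha Q ∘ pt_map = pt_alpha P;
  pt_map_beta : pt_map ∘ pt_beta P = pt_beta Q }.

Lemma pt_hom_eq (P Q : point) (f g : pt_hom P Q) :
  pt_map f = pt_map g -> f = g.
Proof.
  destruct f as [f fa fb], g as [g ga gb]; simpl; intros ->.
  rewrite (proof_irrelevance _ fa ga), (proof_irrelevance _ fb gb). reflexivity.
Qed.

Definition pt_id (P : point) : pt_hom P P.
Proof.
  refine (@PtHom P P (idm _) _ _).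
  - apply id_right.
  - apply id_left.
Defined.

Definition pt_comp (P Q R : point) (g : pt_hom Q R) (f : pt_hom P Q) : pt_hom P R.
Proof.
  refine (@PtHom P R (pt_map g ∘ pt_map f) _ _).
  - rewrite comp_assoc, (pt_map_alpha g). apply (pt_map_alpha f).
  - rewrite <- comp_assoc, (pt_map_beta f). apply (pt_map_beta g).
Defined.

Definition Pt : Category.
Proof.
  refine (@Build_Category point pt_hom pt_id pt_comp _ _ _).
  - intros; apply pt_hom_eq; simpl; apply comp_assoc.
  - intros; apply pt_hom_eq; simpl; apply id_left.
  - intros; apply pt_hom_eq; simpl; apply id_right.
Defined.

Definition ker_functor_value {P Q : point} (f : pt_hom P Q)
    {KP KQ : C} (kP : Hom KP (pt_ob P)) (kQ : Hom KQ (pt_ob Q)) (g : Hom KP KQ) : Prop :=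
  is_kernel kP (pt_alpha P) /\ is_kernel kQ (pt_alpha Q) /\
  kQ ∘ g = pt_map f ∘ kP.

End Points.

Arguments Pt C B : clear implicits.
Arguments pt_map {C B P Q} _.
Arguments ker_functor_value {C B P Q} f {KP KQ} kP kQ g.

Section Notions.
Variable C : Category.

(* protomodularity (pointed, finitely complete case): every kernel functor
   Ker_B reflects isomorphisms (split short five lemma) *)
Definition protomodular : Prop :=
  forall (B : C) (P Q : Pt C B) (f : Hom P Q) (KP KQ : C)
    (kP : Hom KP (pt_ob P)) (kQ : Hom KQ (pt_ob Q)) (g : Hom KP KQ),
    ker_functor_value f kP kQ g -> is_iso g -> is_iso f.

Definition semi_abelian : Prop :=
  pointed C /\ exact C /\ protomodular /\ has_binary_coproducts C.

Definition normal_monos_compose : Prop :=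
  forall (X Y Z : C) (m : Hom X Y) (n : Hom Y Z),
    is_normal_mono m -> is_normal_mono n -> is_normal_mono (n ∘ m).

Definition kernel_functors_preserve_normal_closures : Prop :=
  forall (B : C) (X M N : Pt C B) (m : Hom M X) (n : Hom N X),
    is_mono m -> is_normal_closure n m ->
    forall (KX KM KN : C) (kX : Hom KX (pt_ob X)) (kM : Hom KM (pt_ob M))
      (kN : Hom KN (pt_ob N)) (gm : Hom KM KX) (gn : Hom KN KX),
      ker_functor_value m kM kX gm -> ker_functor_value n kN kX gn ->
      is_normal_closure gn gm.

Definition strongly_protomodular : Prop :=
  forall (B : C) (P Q : Pt C B) (f : Hom P Q) (KP KQ : C)
    (kP : Hom KP (pt_ob P)) (kQ : Hom KQ (pt_ob Q)) (g : Hom KP KQ),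
    ker_functor_value f kP kQ g -> is_normal_mono g -> is_normal_mono f.

Definition huq_commute {X Y A : C} (x : Hom X A) (y : Hom Y A) : Prop :=
  exists (P : C) (p1 : Hom P X) (p2 : Hom P Y) (iX : Hom X P) (iY : Hom Y P)
         (phi : Hom P A),
    is_product p1 p2 /\
    p1 ∘ iX = idm X /\ is_zero_map (p2 ∘ iX) /\
    is_zero_map (p1 ∘ iY) /\ p2 ∘ iY = idm Y /\
    phi ∘ iX = x /\ phi ∘ iY = y.

(* connector between equivalence relations (r1,r2) : R -> A, (s1,s2) : S -> A,
   on the pullback (q1,q2) : R x_A S of r2 and s1:
   p(a,b,b) = a and p(a,a,b) = b *)
Definition has_connector {R S A : C} (r1 r2 : Hom R A) (s1 s2 : Hom S A) : Prop :=
  forall (Q : C) (q1 : Hom Q R) (q2 : Hom Q S), is_pullback q1 q2 r2 s1 ->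
  exists p : Hom Q A,
    forall (dR : Hom A R) (dS : Hom A S),
      r1 ∘ dR = idm A -> r2 ∘ dR = idm A -> s1 ∘ dS = idm A -> s2 ∘ dS = idm A ->
      (forall u : Hom R Q, q1 ∘ u = idm R -> q2 ∘ u = dS ∘ r2 -> p ∘ u = r1) /\
      (forall v : Hom S Q, q1 ∘ v = dR ∘ s1 -> q2 ∘ v = idm S -> p ∘ v = s2).

Definition SH : Prop :=
  forall (A R S : C) (r1 r2 : Hom R A) (s1 s2 : Hom S A),
    is_equivalence_relation r1 r2 -> is_equivalence_relation s1 s2 ->
    forall (KR KS : C) (kR : Hom KR R) (kS : Hom KS S),
      is_kernel kR r1 -> is_kernel kS s1 ->
      huq_commute (r2 ∘ kR) (s2 ∘ kS) ->
      has_connector r1 r2 s1 s2.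

(* m : H -> A is the Higgins commutator [X,Y] of x : X -> A, y : Y -> A:
   the regular image of <x,y> ∘ ker(σ), σ = (1 0; 0 1) : X + Y -> X × Y *)
Definition is_higgins_commutator {X Y A H : C} (x : Hom X A) (y : Hom Y A)
    (m : Hom H A) : Prop :=
  exists (S P K : C) (i1 : Hom X S) (i2 : Hom Y S) (p1 : Hom P X) (p2 : Hom P Y)
         (sigma : Hom S P) (kappa : Hom K S) (c : Hom S A) (e : Hom K H),
    is_coproduct i1 i2 /\ is_product p1 p2 /\
    p1 ∘ sigma ∘ i1 = idm X /\ is_zero_map (p2 ∘ sigma ∘ i1) /\
    is_zero_map (p1 ∘ sigma ∘ i2) /\ p2 ∘ sigma ∘ i2 = idm Y /\
    is_kernel kappa sigma /\
    c ∘ i1 = x /\ c ∘ i2 = y /\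
    is_regular_epi e /\ is_mono m /\ c ∘ kappa = m ∘ e.

Definition NH : Prop :=
  forall (X Y A H : C) (x : Hom X A) (y : Hom Y A) (m : Hom H A),
    is_normal_mono x -> is_normal_mono y ->
    is_higgins_commutator x y m -> is_normal_mono m.

End Notions.

(* Main.v *)
Require Import Defs.

(* For a point over [B] with domain [X], the normal subobjects of the point are
   determined by their kernels, which are exactly the normal subobjects of [X]
   lying in [Ker alpha]. Since [Ker alpha] is normal in [X], transitivity of
   normality says that these are also exactly the normal subobjects of
   [Ker alpha]; this gives (1) and (2). For (3), the product decomposition
   obtained from Huq commutation makes the normalisation of [R] normal in
   [R x_A S], and the quotient by it retracts onto [S], which is a connector.
   For (4), the Higgins commutator is normal in the join, and the join is normal. *)


(** * Zero maps, kernels, pullbacks and products in an arbitrary category *)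

Section Generalities.
Context {C : Category}.

(** In composites bracketed to the right, [f ∘ g] is a subterm only at the end of a chain; this form
    rewrites it in the middle. *)
Lemma comp_tail {A B D : C} {f : Hom B D} {g : Hom A B} {h : Hom A D} :
  f ∘ g = h -> forall W (x : Hom W A), f ∘ (g ∘ x) = h ∘ x.
Proof. intros <- W x; apply comp_assoc. Qed.

Lemma mono_comp {A B D : C} (f : Hom B D) (g : Hom A B) :
  is_mono f -> is_mono g -> is_mono (f ∘ g).
Proof.
  intros Hf Hg W u v E. apply Hg, Hf. rewrite !comp_assoc; exact E.
Qed.

Lemma mono_of_comp {A B D : C} (f : Hom B D) (g : Hom A B) :
  is_mono (f ∘ g) -> is_mono g.
Proof.
  intros H W u v E. apply H. rewrite <- !comp_assoc, E. reflexivity.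
Qed.

Lemma zero_post {A B D : C} (f : Hom B D) (g : Hom A B) :
  is_zero_map g -> is_zero_map (f ∘ g).
Proof.
  intros (Z & a & b & HZ & ->). exists Z, a, (f ∘ b). now rewrite comp_assoc.
Qed.

Lemma zero_pre {A B D : C} (f : Hom B D) (g : Hom A B) :
  is_zero_map f -> is_zero_map (f ∘ g).
Proof.
  intros (Z & a & b & HZ & ->). exists Z, (a ∘ g), b. now rewrite comp_assoc.
Qed.

Lemma zero_unique {A B : C} (f g : Hom A B) :
  is_zero_map f -> is_zero_map g -> f = g.
Proof.
  intros (Z & a & b & [HZi HZt] & ->) (Z' & a' & b' & [HZi' HZt'] & ->).
  (* The two maps may pass through different zero objects; [t] compares these. *)
  destruct (HZi Z') as [t _].
  destruct (HZi B) as [b0 Hb]. destruct (HZt' A) as [a0 Ha].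
  rewrite (Hb b), <- (Hb (b' ∘ t)), <- comp_assoc.
  now rewrite (Ha a'), (Ha (t ∘ a)).
Qed.

Lemma zero_exists (ptd : pointed C) (A B : C) : exists f : Hom A B, is_zero_map f.
Proof.
  destruct ptd as [Z [Hi Ht]].
  destruct (Ht A) as [a _], (Hi B) as [b _].
  exists (b ∘ a), Z, a, b. now repeat split.
Qed.

Lemma zero_of_mono (ptd : pointed C) {A B D : C} {m : Hom B D} {f : Hom A B} :
  is_mono m -> is_zero_map (m ∘ f) -> is_zero_map f.
Proof.
  intros Hm Hz. destruct (zero_exists ptd A B) as [z Z].
  replace f with z; [exact Z |].
  apply Hm, zero_unique; [now apply zero_post | exact Hz].
Qed.

Lemma kernel_lift {K A B : C} {k : Hom K A} {f : Hom A B} :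
  is_kernel k f -> forall {W} (g : Hom W A), is_zero_map (f ∘ g) ->
  factors_through g k.
Proof. intros [_ H] W g Hg. destruct (H W g Hg) as (u & Hu & _). now exists u. Qed.

Lemma kernel_mono {K A B : C} {k : Hom K A} {f : Hom A B} :
  is_kernel k f -> is_mono k.
Proof.
  intros [Hz H] W u v E.
  destruct (H W (k ∘ u)) as (w & _ & Hw).
  - rewrite comp_assoc. now apply zero_pre.
  - rewrite (Hw u eq_refl). symmetry. now apply Hw.
Qed.

Lemma kernel_intro {K A B : C} (k : Hom K A) (f : Hom A B) :
  is_mono k -> is_zero_map (f ∘ k) ->
  (forall W (g : Hom W A), is_zero_map (f ∘ g) -> factors_through g k) ->
  is_kernel k f.
Proof.
  intros Hm Hz H. split; [exact Hz |]. intros W g Hg.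
  destruct (H W g Hg) as [u Hu]. exists u. split; [exact Hu |].
  intros v Hv. apply Hm. now rewrite Hu.
Qed.

Lemma pullback_lift {P X Y Z : C} {p1 : Hom P X} {p2 : Hom P Y}
    {f : Hom X Z} {g : Hom Y Z} :
  is_pullback p1 p2 f g -> forall {W} (a : Hom W X) (b : Hom W Y), f ∘ a = g ∘ b ->
  exists u, p1 ∘ u = a /\ p2 ∘ u = b.
Proof. intros [_ H] W a b E. destruct (H W a b E) as (u & Hu & _). now exists u. Qed.

Lemma pullback_ext {P X Y Z : C} {p1 : Hom P X} {p2 : Hom P Y}
    {f : Hom X Z} {g : Hom Y Z} :
  is_pullback p1 p2 f g -> forall W (u v : Hom W P),
  p1 ∘ u = p1 ∘ v -> p2 ∘ u = p2 ∘ v -> u = v.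
Proof.
  intros [E H] W u v E1 E2.
  destruct (H W (p1 ∘ v) (p2 ∘ v)) as (w & _ & Hw).
  - now rewrite !comp_assoc, E.
  - rewrite (Hw u E1 E2). symmetry. now apply Hw.
Qed.

Lemma pullback_mono {P X Y Z : C} {p1 : Hom P X} {p2 : Hom P Y}
    {f : Hom X Z} {g : Hom Y Z} :
  is_pullback p1 p2 f g -> is_mono g -> is_mono p1.
Proof.
  intros HP Hg W u v E. apply (pullback_ext HP); [exact E |].
  apply Hg. destruct HP as [EP _]. now rewrite !comp_assoc, <- EP, <- !comp_assoc, E.
Qed.

Lemma product_lift {P X Y : C} {p1 : Hom P X} {p2 : Hom P Y} :
  is_product p1 p2 -> forall {W} (a : Hom W X) (b : Hom W Y),
  exists u, p1 ∘ u = a /\ p2 ∘ u = b.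
Proof. intros H W a b. destruct (H W a b) as (u & Hu & _). now exists u. Qed.

Lemma product_ext {P X Y : C} {p1 : Hom P X} {p2 : Hom P Y} :
  is_product p1 p2 -> forall W (u v : Hom W P),
  p1 ∘ u = p1 ∘ v -> p2 ∘ u = p2 ∘ v -> u = v.
Proof.
  intros H W u v E1 E2. destruct (H W (p1 ∘ v) (p2 ∘ v)) as (w & _ & Hw).
  rewrite (Hw u E1 E2). symmetry. now apply Hw.
Qed.

Lemma product_exists (fc : finitely_complete C) (X Y : C) :
  exists (P : C) (p1 : Hom P X) (p2 : Hom P Y), is_product p1 p2.
Proof.
  destruct fc as [[T HT] pb]. destruct (HT X) as [x _], (HT Y) as [y _].
  destruct (pb X Y T x y) as (P & p1 & p2 & [_ HP]). exists P, p1, p2.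
  intros W a b. apply HP. destruct (HT W) as [w Hw].
  now rewrite (Hw (x ∘ a)), (Hw (y ∘ b)).
Qed.

End Generalities.

(** * Rewriting modulo associativity, and recognition of zero maps *)

Ltac norm := rewrite <- ?comp_assoc, ?id_left, ?id_right.
Ltac crw1 H := norm; first [rewrite H | rewrite (comp_tail H)]; norm.
Tactic Notation "crw" constr(a) := crw1 a.
Tactic Notation "crw" constr(a) "," constr(b) := crw1 a; crw1 b.
Tactic Notation "crw" constr(a) "," constr(b) "," constr(c) := crw1 a; crw1 b; crw1 c.
Tactic Notation "crw" constr(a) "," constr(b) "," constr(c) "," constr(d) :=
  crw1 a; crw1 b; crw1 c; crw1 d.
Ltac zero := norm;
  lazymatch goal with |- is_zero_map _ => idtac end;
  first [assumption | apply zero_pre; assumption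
    | match goal with
      | H : is_zero_map (?f ∘ ?g) |- is_zero_map (?f ∘ (?g ∘ ?x)) =>
          rewrite (comp_assoc _ _ _ _ _ f g x); apply zero_pre; exact H
      | H : is_kernel ?g ?f |- is_zero_map (?f ∘ (?g ∘ ?x)) =>
          rewrite (comp_assoc _ _ _ _ _ f g x); apply zero_pre; apply H
      | H : is_kernel ?g ?f |- is_zero_map (?f ∘ ?g) => apply H
      end
    | apply zero_post; solve [zero]].
Ltac both_zero := apply zero_unique; zero.

(** * Split epimorphisms and relations in a pointed protomodular category *)

Section SemiAbelian.
Context {C : Category} (ptd : pointed C) (fc : finitely_complete C) (pm : protomodular C).

Lemma kernel_exists {A B : C} (f : Hom A B) : exists (K : C) (k : Hom K A), is_kernel k f.
Proof.
  destruct ptd as [Z [Hi Ht]]. destruct (Hi B) as [z _].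
  destruct (proj2 fc A Z B f z) as (K & k & t & HK).
  assert (HZ : is_zero_object C Z) by (split; assumption).
  exists K, k. apply kernel_intro.
  - apply (pullback_mono HK). intros W u v _.
    destruct (Ht W) as [w Hw]. now rewrite (Hw u), (Hw v).
  - exists Z, t, z. split; [exact HZ | apply HK].
  - intros W g Hg. destruct (Ht W) as [w _].
    destruct (pullback_lift HK g w) as (u & Hu & _); [| now exists u].
    apply zero_unique; [exact Hg |]. now exists Z, w, z.
Qed.

Lemma split_short_five {B A A' K : C} (a : Hom A B) (b : Hom B A)
    (a' : Hom A' B) (b' : Hom B A') (f : Hom A A') (k : Hom K A) :
  a ∘ b = idm B -> a' ∘ b' = idm B -> a' ∘ f = a -> f ∘ b = b' ->
  is_kernel k a -> is_kernel (f ∘ k) a' -> is_iso f.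
Proof.
  intros Eab Eab' Ea Eb Hk Hk'.
  pose (P := @Point C B A a b Eab). pose (P' := @Point C B A' a' b' Eab').
  pose (F := @PtHom C B P P' f Ea Eb).
  destruct (@pm B P P' F K K k (f ∘ k) (idm K)) as (g & G1 & G2).
  - repeat split; try apply Hk; try apply Hk'. now rewrite id_right.
  - exists (idm K). now rewrite id_left.
  - exists (pt_map g). split; [apply (f_equal (@pt_map C B P P) G1) | apply (f_equal (@pt_map C B P' P') G2)].
Qed.

(* The kernel and the section of a split epimorphism together generate its
   domain: no proper subobject contains both. *)
Lemma factor_on_point {B A K X M : C} {a : Hom A B} {b : Hom B A} {k : Hom K A}
    (x : Hom A X) (m : Hom M X) :
  a ∘ b = idm B -> is_kernel k a -> is_mono m ->
  factors_through (x ∘ k) m -> factors_through (x ∘ b) m -> factors_through x m.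
Proof.
  intros Eab Hk Hm [k' Ek] [b' Eb].
  destruct (proj2 fc _ _ _ x m) as (E & i & j & HE).
  assert (Hi := pullback_mono HE Hm).
  destruct (pullback_lift HE k k' (eq_sym Ek)) as (k1 & Hk1 & _).
  destruct (pullback_lift HE b b' (eq_sym Eb)) as (b1 & Hb1 & _).
  destruct (@split_short_five B E A K (a ∘ i) b1 a b i k1) as (r & _ & Hr);
    try easy.
  - now crw Hb1.
  - apply kernel_intro.
    + apply (@mono_of_comp _ _ _ _ i). rewrite Hk1. apply (kernel_mono Hk).
    + crw Hk1. apply Hk.
    + intros W g Hg. destruct (kernel_lift Hk (i ∘ g)) as [u Hu].
      * now rewrite comp_assoc.
      * exists u. apply Hi. now crw Hk1.
  - now rewrite Hk1.
  - exists (j ∘ r). crw (eq_sym (proj1 HE)), Hr. reflexivity.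
Qed.

(** The pair [(x, y)] factors through the diagonal of [X] on the kernel and on the section, hence
    everywhere. *)
Lemma jointly_epic {B A K X : C} {a : Hom A B} {b : Hom B A} {k : Hom K A}
    {x y : Hom A X} :
  a ∘ b = idm B -> is_kernel k a -> x ∘ k = y ∘ k -> x ∘ b = y ∘ b -> x = y.
Proof.
  intros Eab Hk Ek Eb.
  destruct (product_exists fc X X) as (D & d1 & d2 & HD).
  destruct (product_lift HD x y) as (xy & H1 & H2).
  destruct (product_lift HD (idm X) (idm X)) as (d & E1 & E2).
  destruct (factor_on_point xy d Eab Hk) as [u Hu]; try easy.
  - intros W u v E. rewrite <- (id_left _ _ _ u), <- (id_left _ _ _ v), <- E1.
    now rewrite <- !comp_assoc, E.
  - exists (x ∘ k). apply (product_ext HD); [crw E1, H1 | crw E2, H2]; easy.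
  - exists (x ∘ b). apply (product_ext HD); [crw E1, H1 | crw E2, H2]; easy.
  - rewrite <- H1, <- H2, <- Hu. now crw E1, E2.
Qed.

(** In the kernel pair of [f], the diagonal splits [p1], and [p2] kills the kernel of [p1]; so the
    two projections agree. *)
Lemma mono_of_zero_kernel {X Y : C} (f : Hom X Y) :
  (forall W (h : Hom W X), is_zero_map (f ∘ h) -> is_zero_map h) -> is_mono f.
Proof.
  intros H W u v E.
  destruct (proj2 fc _ _ _ f f) as (P & p1 & p2 & HP).
  destruct (pullback_lift HP (idm X) (idm X) eq_refl) as (d & E1 & E2).
  destruct (kernel_exists p1) as (K & k & Hk).
  assert (Ep : p1 = p2).
  { apply (jointly_epic E1 Hk); [| now rewrite E1].
    apply zero_unique; [apply Hk |].
    apply H. rewrite comp_assoc, <- (proj1 HP), <- comp_assoc. apply zero_post, Hk. }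
  destruct (pullback_lift HP u v E) as (w & <- & <-). now rewrite Ep.
Qed.

(** [Q] consists of the triples [(a, b, c)] as in the hypotheses, and [s] sends [(a, b)] to
    [(a, b, b)]. The pair [(t1 a, t2 c)] lies in the relation on the image of [s], where [a]
    witnesses it, and on the kernel of [w1], where [c] does; hence on all of [Q]. *)
Lemma difunctional {T X Y : C} {t1 : Hom T X} {t2 : Hom T Y} :
  (forall W (u v : Hom W T), t1 ∘ u = t1 ∘ v -> t2 ∘ u = t2 ∘ v -> u = v) ->
  forall {W} (a b c : Hom W T), t2 ∘ a = t2 ∘ b -> t1 ∘ b = t1 ∘ c ->
  exists d : Hom W T, t1 ∘ d = t1 ∘ a /\ t2 ∘ d = t2 ∘ c.
Proof.
  intros Hjm W a b c Eab Ebc.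
  destruct (proj2 fc _ _ _ t2 t2) as (R & u & u' & HR).
  destruct (proj2 fc _ _ _ t1 t1) as (S & v & v' & HS).
  destruct (proj2 fc _ _ _ u' v) as (Q & w1 & w2 & HQ).
  destruct (product_exists fc X Y) as (D & d1 & d2 & HD).
  destruct (product_lift HD (t1 ∘ (u ∘ w1)) (t2 ∘ (v' ∘ w2))) as (x & X1 & X2).
  destruct (product_lift HD t1 t2) as (m & M1 & M2).
  destruct (pullback_lift HS u' u' eq_refl) as (s' & S1 & S2).
  destruct (pullback_lift HQ (idm R) s') as (s & S3 & S4).
  { now rewrite S1, id_right. }
  destruct (kernel_exists w1) as (K & k & Hk).
  destruct (factor_on_point x m S3 Hk) as [z Hz]; try easy.
  - intros V f g E. apply Hjm; [rewrite <- M1 | rewrite <- M2];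
      now rewrite <- !comp_assoc, E.
  - exists (v' ∘ (w2 ∘ k)). apply (product_ext HD).
    + crw M1, X1. rewrite (comp_tail (eq_sym (proj1 HS))). norm.
      rewrite (comp_tail (eq_sym (proj1 HQ))). norm.
      both_zero.
    + now crw M2, X2.
  - exists u. apply (product_ext HD).
    + now crw M1, X1, S3.
    + crw M2, X2, S4, S2. apply HR.
  - destruct (pullback_lift HR a b Eab) as (r & R1 & R2).
    destruct (pullback_lift HS b c Ebc) as (r' & R3 & R4).
    destruct (pullback_lift HQ r r') as (q & Q1 & Q2); [congruence |].
    exists (z ∘ q). split.
    + transitivity (d1 ∘ (m ∘ (z ∘ q))); [now crw M1 |]. crw Hz, X1, Q1, R1. reflexivity.
    + transitivity (d2 ∘ (m ∘ (z ∘ q))); [now crw M2 |]. crw Hz, X2, Q2, R4. reflexivity.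
Qed.

(** Difunctionality gives symmetry from the pairs [(y, y)], [(x, y)], [(x, x)] and transitivity from
    [(x, y)], [(y, y)], [(y, z)]. *)
Lemma reflexive_relation_equivalence {T X : C} (t1 t2 : Hom T X) (d : Hom X T) :
  (forall W (u v : Hom W T), t1 ∘ u = t1 ∘ v -> t2 ∘ u = t2 ∘ v -> u = v) ->
  t1 ∘ d = idm X -> t2 ∘ d = idm X -> is_equivalence_relation t1 t2.
Proof.
  intros Hjm D1 D2. repeat split.
  - exact Hjm.
  - now exists d.
  - destruct (difunctional Hjm (d ∘ t2) (idm T) (d ∘ t1)) as (s & E1 & E2).
    + now crw D2.
    + now crw D1.
    + exists s. rewrite E1, E2. now crw D1, D2.
  - intros P p1 p2 HP.
    destruct (difunctional Hjm p1 (d ∘ (t2 ∘ p1)) p2) as (s & E1 & E2).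
    + now crw D2.
    + crw D1. apply HP.
    + exists s. rewrite E1, E2. split; [easy |]. reflexivity.
Qed.

(** * Kernels in the category of points, compared with kernels in [C] *)

Lemma pt_zero_iff {B : C} {P Q : Pt C B} (f : Hom P Q) :
  is_zero_map f <-> pt_map f = pt_beta Q ∘ pt_alpha P.
Proof.
  split.
  - intros (Z & a & b & [_ HZ] & ->).
    (* This composite is an endomorphism of a zero object, hence the identity. *)
    assert (E : pt_beta Z ∘ pt_alpha Z = idm (pt_ob Z)).
    { unshelve epose (g := @PtHom C B Z Z (pt_beta Z ∘ pt_alpha Z) _ _).
      - crw (pt_split Z). reflexivity.
      - crw (pt_split Z). reflexivity.
      - destruct (HZ Z) as [w Hw].
        assert (Eg : g = pt_id Z) by (rewrite (Hw g); symmetry; apply Hw).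
        exact (f_equal (@pt_map _ _ _ _) Eg). }
    change (pt_map b ∘ pt_map a = pt_beta Q ∘ pt_alpha P).
    rewrite <- (id_left _ _ _ (pt_map a)), <- E, <- (pt_map_beta b), <- (pt_map_alpha a).
    now rewrite <- !comp_assoc.
  - intros E.
    pose (Z := @Point C B B (idm B) (idm B) (id_left _ _ _ (idm B))).
    unshelve epose (a := @PtHom C B P Z (pt_alpha P) _ _).
    { apply id_left. } { apply pt_split. }
    unshelve epose (b := @PtHom C B Z Q (pt_beta Q) _ _).
    { apply pt_split. } { apply id_right. }
    exists Z, a, b. repeat split.
    + intros X. unshelve eexists (@PtHom C B Z X (pt_beta X) _ _).
      { apply pt_split. } { apply id_right. }
      intros g. apply pt_hom_eq. simpl. rewrite <- (pt_map_beta g). symmetry; apply id_right.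
    + intros X. unshelve eexists (@PtHom C B X Z (pt_alpha X) _ _).
      { apply id_left. } { apply pt_split. }
      intros g. apply pt_hom_eq. simpl. rewrite <- (pt_map_alpha g). symmetry; apply id_left.
    + apply pt_hom_eq. exact E.
Qed.

Lemma pt_zero_of_kernel {B : C} {P Q : Pt C B} (f : Hom P Q) {K : C} {k : Hom K (pt_ob P)} :
  is_kernel k (pt_alpha P) -> is_zero_map (pt_map f ∘ k) -> is_zero_map f.
Proof.
  intros Hk Hz. apply pt_zero_iff.
  apply (jointly_epic (pt_split P) Hk).
  - both_zero.
  - crw (pt_split P). apply pt_map_beta.
Qed.

Lemma alpha_zero {B : C} {Q Y : Pt C B} (F : Hom Q Y) {W : C} (h : Hom W (pt_ob Q)) :
  is_zero_map (pt_map F ∘ h) -> is_zero_map (pt_alpha Q ∘ h).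
Proof. intros H. rewrite <- (pt_map_alpha F). zero. Qed.

(** A morphism of points killed by [F] lands in [f] on the kernel by hypothesis and on the section
    automatically, so [factor_on_point] applies. *)
Lemma kernel_pt_of_kernel {B : C} {P Q Y : Pt C B} (f : Hom P Q) (F : Hom Q Y)
    {K : C} {k : Hom K (pt_ob P)} :
  is_kernel k (pt_alpha P) -> is_kernel (pt_map f ∘ k) (pt_map F) -> is_kernel f F.
Proof.
  intros Hk HK.
  assert (Hm : is_mono (pt_map f)).
  { apply mono_of_zero_kernel. intros W h Hh.
    destruct (kernel_lift Hk h) as [l Hl].
    - now apply (alpha_zero f).
    - rewrite <- Hl. apply zero_post.
      apply (zero_of_mono ptd (kernel_mono HK)). norm. now rewrite Hl. }
  apply kernel_intro.
  - intros W u v E. apply pt_hom_eq, Hm. exact (f_equal (@pt_map _ _ _ _) E).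
  - apply (pt_zero_of_kernel (comp (c := Pt C B) F f) (k := k)); [exact Hk |].
    simpl. rewrite <- comp_assoc. apply HK.
  - intros W g Hg. destruct (kernel_exists (pt_alpha W)) as (L & l & Hl).
    destruct (factor_on_point (pt_map g) (pt_map f) (pt_split W) Hl Hm) as [u Hu].
    + apply pt_zero_iff in Hg. simpl in Hg.
      destruct (kernel_lift HK (pt_map g ∘ l)) as [w Hw].
      * rewrite comp_assoc, Hg. zero.
      * exists (k ∘ w). now rewrite comp_assoc.
    + exists (pt_beta P). rewrite (pt_map_beta g). apply pt_map_beta.
    + unshelve eexists (@PtHom C B W P u _ _).
      * rewrite <- (pt_map_alpha f), <- comp_assoc, Hu. apply pt_map_alpha.
      * apply Hm. crw Hu. rewrite (pt_map_beta g). symmetry; apply pt_map_beta.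
      * now apply pt_hom_eq.
Qed.

(** [P] is the pullback of [F] along the section of [Y]; its part over zero is the ordinary kernel
    of [F]. *)
Lemma kernel_pt_exists {B : C} {Q Y : Pt C B} (F : Hom Q Y) {K : C} {k : Hom K (pt_ob Q)} :
  is_kernel k (pt_map F) ->
  exists (P : Pt C B) (f : Hom P Q) (kP : Hom K (pt_ob P)),
    is_kernel kP (pt_alpha P) /\ pt_map f ∘ kP = k.
Proof.
  intros HK.
  destruct (proj2 fc _ _ _ (pt_map F) (pt_beta Y)) as (N & n & a & HN).
  destruct (pullback_lift HN (pt_beta Q) (idm B)) as (b & B1 & B2).
  { rewrite id_right. apply pt_map_beta. }
  assert (Ea : pt_alpha Q ∘ n = a).
  { rewrite <- (pt_map_alpha F), <- comp_assoc, (proj1 HN), comp_assoc, (pt_split Y).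
    apply id_left. }
  pose (P := @Point C B N a b B2).
  pose (f := @PtHom C B P Q n Ea B1).
  destruct (zero_exists ptd K B) as [z Hz].
  destruct (pullback_lift HN k z) as (kP & K1 & K2).
  { apply zero_unique; [apply HK | zero]. }
  exists P, f, kP. split; [| exact K1].
  apply kernel_intro; simpl.
  - apply (@mono_of_comp _ _ _ _ n). rewrite K1. apply (kernel_mono HK).
  - now rewrite K2.
  - intros W g Hg. destruct (kernel_lift HK (n ∘ g)) as [u Hu].
    + crw (proj1 HN). zero.
    + exists u. apply (pullback_ext HN).
      * now crw K1.
      * crw K2. both_zero.
Qed.

(** The ordinary kernel of [f] comes from a morphism of points [i] with [f ∘ i] zero; cancelling [f]
    makes [i] zero, so that kernel is trivial. *)
Lemma pt_map_mono {B : C} {P Q : Pt C B} (f : Hom P Q) : is_mono f -> is_mono (pt_map f).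
Proof.
  intros Hf. apply mono_of_zero_kernel. intros W h Hh.
  destruct (kernel_exists (pt_map f)) as (L & l & Hl).
  destruct (kernel_pt_exists f Hl) as (P' & i & k & Hk & <-).
  destruct (kernel_lift Hl h Hh) as [u <-].
  apply zero_pre. rewrite (proj1 (pt_zero_iff i)); [zero |].
  unshelve epose (z := @PtHom C B P' P (pt_beta P ∘ pt_alpha P') _ _).
  { crw (pt_split P). reflexivity. }
  { crw (pt_split P'). reflexivity. }
  replace i with z; [now apply pt_zero_iff |].
  apply Hf, zero_unique.
  - apply zero_post. now apply pt_zero_iff.
  - apply (pt_zero_of_kernel (comp (c := Pt C B) f i) Hk).
    simpl. rewrite <- comp_assoc. apply Hl.
Qed.

(** [kernel_pt_exists] realises the ordinary kernel of [F] by a morphism of points [f'], which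
    factors through [f]. *)
Lemma kernel_of_kernel_pt {B : C} {P Q Y : Pt C B} (f : Hom P Q) (F : Hom Q Y)
    {K : C} {k : Hom K (pt_ob P)} :
  is_kernel k (pt_alpha P) -> is_kernel f F -> is_kernel (pt_map f ∘ k) (pt_map F).
Proof.
  intros Hk HF. apply kernel_intro.
  - apply mono_comp; [apply pt_map_mono, (kernel_mono HF) | apply (kernel_mono Hk)].
  - pose proof (proj1 (pt_zero_iff _) (proj1 HF)) as E. simpl in E.
    rewrite comp_assoc, E. zero.
  - intros W g Hg.
    destruct (kernel_exists (pt_map F)) as (L & l & Hl).
    destruct (kernel_pt_exists F Hl) as (P' & f' & l' & Hl' & El).
    destruct (kernel_lift HF f') as [v Hv].
    { apply (kernel_pt_of_kernel f' F Hl'). now rewrite El. }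
    apply (f_equal (@pt_map _ _ _ _)) in Hv. simpl in Hv.
    destruct (kernel_lift Hl g Hg) as [u <-].
    destruct (kernel_lift Hk (pt_map v ∘ (l' ∘ u))) as [t Ht].
    { crw (pt_map_alpha v). zero. }
    exists t. crw Ht, Hv. now rewrite <- El, <- comp_assoc.
Qed.

(** Pairing [f] with [pt_alpha Q] gives a map over [B] into a product, which becomes a point through
    the image of the section. The kernel is unchanged because [n] already lies over zero. *)
Lemma kernel_over_base {B : C} {Q : Pt C B} {L : C} (n : Hom L (pt_ob Q)) :
  is_normal_mono n -> is_zero_map (pt_alpha Q ∘ n) ->
  exists (Y : Pt C B) (F : Hom Q Y), is_kernel n (pt_map F).
Proof.
  intros (Z & f & Hf) Hn.
  destruct (product_exists fc Z B) as (D & d1 & d2 & HD).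
  destruct (product_lift HD f (pt_alpha Q)) as (g & G1 & G2).
  assert (Es : d2 ∘ (g ∘ pt_beta Q) = idm B) by (crw G2; apply pt_split).
  pose (Y := @Point C B D d2 (g ∘ pt_beta Q) Es).
  exists Y, (@PtHom C B Q Y g G2 eq_refl). simpl. apply kernel_intro.
  - apply (kernel_mono Hf).
  - destruct (zero_exists ptd L D) as [z Hz]. replace (g ∘ n) with z; [exact Hz |].
    apply (product_ext HD); [crw G1 | crw G2]; both_zero.
  - intros W h Hh. apply (kernel_lift Hf). rewrite <- G1. zero.
Qed.

(** * Strong protomodularity and normal closures from transitivity of normality *)

Context (nmc : normal_monos_compose C).

(** By transitivity [kQ ∘ g] is normal in the domain of [Q]; lying over zero, it is the kernel of a
    morphism of points [F], and [f] is then the kernel of [F]. *)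
Lemma strong_protomodularity : strongly_protomodular C.
Proof.
  intros B P Q f KP KQ kP kQ g (HP & HQ & E) Hg.
  destruct (kernel_over_base (Q := Q) (kQ ∘ g)) as (Y & F & HF).
  - apply nmc; [exact Hg | now exists B, (pt_alpha Q)].
  - zero.
  - exists Y, F. apply (kernel_pt_of_kernel f F HP). now rewrite <- E.
Qed.

Lemma preservation_of_normal_closures : kernel_functors_preserve_normal_closures C.
Proof.
  intros B X M N m n _ (Hn & [u Hu] & Hmin) KX KM KN kX kM kN gm gn
    (HM & HX & Em) (HN & _ & En).
  apply (f_equal (@pt_map _ _ _ _)) in Hu. simpl in Hu.
  assert (Hg : is_mono gn).
  { apply (@mono_of_comp _ _ _ _ kX). rewrite En. destruct Hn as (Y & F & HF).
    apply (kernel_mono (kernel_of_kernel_pt n F HN HF)). }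
  split; [| split].
  - destruct Hn as (Y & F & HF).
    assert (HK := kernel_of_kernel_pt n F HN HF). rewrite <- En in HK.
    exists (pt_ob Y), (pt_map F ∘ kX). apply kernel_intro; [exact Hg | |].
    + norm. apply HK.
    + intros W h Hh. destruct (kernel_lift HK (kX ∘ h)) as [l Hl]; [now rewrite comp_assoc |].
      exists l. apply (kernel_mono HX). now rewrite comp_assoc.
  - destruct (kernel_lift HN (pt_map u ∘ kM)) as [l Hl].
    + crw (pt_map_alpha u). zero.
    + exists l. apply (kernel_mono HX). crw En, Hl, Hu. easy.
  - intros N' n' Hn' [w Hw].
    (* For minimality, [n'] is promoted to a normal subobject [f] of the point [X], to be compared
       with [n]. *)
    destruct (kernel_over_base (Q := X) (kX ∘ n')) as (Y & F & HF).
    { apply nmc; [exact Hn' | now exists B, (pt_alpha X)]. }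
    { zero. }
    destruct (kernel_pt_exists F HF) as (P & f & k & Hk & Ek).
    assert (Hf : is_kernel f F).
    { apply (kernel_pt_of_kernel f F Hk). now rewrite Ek. }
    destruct (Hmin P f) as [z Hz].
    + now exists Y, F.
    + apply (kernel_lift Hf).
      apply (pt_zero_of_kernel (comp (c := Pt C B) F m) HM).
      simpl. norm. rewrite <- Em, <- Hw. rewrite (comp_assoc _ _ _ _ _ kX n' w), comp_assoc.
      apply zero_pre, HF.
    + apply (f_equal (@pt_map _ _ _ _)) in Hz. simpl in Hz.
      destruct (kernel_lift Hk (pt_map z ∘ kN)) as [l Hl].
      * crw (pt_map_alpha z). zero.
      * exists l. apply (kernel_mono HX). rewrite En, <- Hz.
        crw (eq_sym Hl). rewrite (comp_tail Ek). apply comp_assoc.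
Qed.

(** * The connector required by (SH) *)

Context (ex : exact C).

(* Elements of [Q] are triples [b R a S c], seen as a point over [A] through
   [b]. The kernel of [Q -> A] is [KR x KS] because the normalisations commute,
   so the image of [KR] under [(b,a) |-> (b,a,a)] is normal in it, hence in [Q].
   Dividing [Q] by it retracts [Q] onto the triples [(a,a,c)]. *)
Lemma normal_monos_compose_SH : SH C.
Proof.
  intros A R S r1 r2 s1 s2 HR HS KR KS kR kS HkR HkS
    (P & p1 & p2 & iX & iY & phi & HP & P1X & P2X & P1Y & P2Y & PhiX & PhiY)
    Q q1 q2 HQ.
  destruct HR as (jmR & (dR & R1 & R2) & _).
  destruct (proj2 ex _ _ _ _ HS) as (Z & f & Hf).
  destruct HS as (jmS & (dS & S1 & S2) & _).
  (* As triples, [u] gives [(b, a, a)], [v] gives [(a, a, c)] and [b] gives [(a, a, a)]. *)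
  destruct (pullback_lift HQ (idm R) (dS ∘ r2)) as (u & U1 & U2); [now crw S1 |].
  destruct (pullback_lift HQ (dR ∘ s1) (idm S)) as (v & V1 & V2); [now crw R2 |].
  destruct (pullback_lift HQ dR dS) as (b & B1 & B2); [now rewrite R2 |].
  assert (HiY : is_kernel iY p1).
  { apply kernel_intro; [| exact P1Y |].
    - intros W x y E. rewrite <- (id_left _ _ _ x), <- (id_left _ _ _ y), <- P2Y.
      now rewrite <- !comp_assoc, E.
    - intros W g Hg. exists (p2 ∘ g). apply (product_ext HP).
      + both_zero.
      + now crw P2Y. }
  assert (HiX : is_kernel iX p2).
  { apply kernel_intro; [| exact P2X |].
    - intros W x y E. rewrite <- (id_left _ _ _ x), <- (id_left _ _ _ y), <- P1X.
      now rewrite <- !comp_assoc, E.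
    - intros W g Hg. exists (p1 ∘ g). apply (product_ext HP).
      + now crw P1X.
      + both_zero. }
  (* [S] is the kernel pair of [f], so [x] and [phi (x, y)] are [S]-related once [f] identifies
     them, which is checked on both factors. Thus [t] sends [(x, y)] to the triple
     [(0, x, phi (x, y))]. *)
  destruct (pullback_lift Hf (r2 ∘ (kR ∘ p1)) phi) as (s' & S3 & S4).
  { apply (jointly_epic P1X HiY).
    - crw PhiY. rewrite (comp_tail (eq_sym (proj1 Hf))). both_zero.
    - crw P1X, PhiX. reflexivity. }
  destruct (pullback_lift HQ (kR ∘ p1) s') as (t & T1 & T2); [now rewrite S3 |].
  assert (TX : t ∘ iX = u ∘ kR).
  { apply (pullback_ext HQ).
    - crw T1, U1, P1X. reflexivity.
    - crw T2, U2. apply jmS.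
      + crw S3, S1, P1X. reflexivity.
      + crw S4, S2, PhiX. reflexivity. }
  assert (TY : t ∘ iY = v ∘ kS).
  { apply (pullback_ext HQ).
    - crw T1, V1. both_zero.
    - crw T2, V2. apply jmS.
      + crw S3. both_zero.
      + crw S4. exact PhiY. }
  assert (Ht : is_kernel t (r1 ∘ q1)).
  { destruct (kernel_exists (r1 ∘ q1)) as (K & k & Hk).
    assert (Hk0 : is_zero_map (r1 ∘ (q1 ∘ k))) by (rewrite comp_assoc; apply Hk).
    destruct (kernel_lift HkR (q1 ∘ k) Hk0) as [zt Zt].
    destruct (kernel_lift Hk t) as [th Th]; [crw T1; zero |].
    assert (E : zt ∘ th = p1).
    { apply (kernel_mono HkR). crw Zt, Th. exact T1. }
    (* Both [P] and [K] are split over [KR] with kernel [KS], so the comparison [th] is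
       invertible. *)
    destruct (@split_short_five KR P K KS p1 iX zt (th ∘ iX) th iY) as (w & W1 & W2);
      try easy.
    - crw E. exact P1X.
    - apply kernel_intro.
      + apply (@mono_of_comp _ _ _ _ (s2 ∘ (q2 ∘ k))). crw Th, T2.
        rewrite (comp_tail S4), PhiY. intros V x y Exy. apply (kernel_mono HkS).
        apply jmS; [both_zero | now rewrite !comp_assoc].
      + crw E. exact P1Y.
      + intros V g Hg.
        assert (Hg1 : is_zero_map (q1 ∘ (k ∘ g))).
        { crw (eq_sym Zt). zero. }
        destruct (kernel_lift HkS (q2 ∘ (k ∘ g))) as [l Hl].
        { rewrite comp_assoc, <- (proj1 HQ). zero. }
        exists l. apply (kernel_mono Hk). crw Th. rewrite (comp_tail TY). norm.
        apply (pullback_ext HQ).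
        * crw V1. both_zero.
        * crw V2. exact Hl.
    - apply kernel_intro.
      + rewrite <- Th. apply mono_comp; [apply (kernel_mono Hk) |].
        intros V x y Exy. rewrite <- (id_left _ _ _ x), <- (id_left _ _ _ y), <- W1.
        now rewrite <- !comp_assoc, Exy.
      + crw T1. zero.
      + intros V g Hg. destruct (kernel_lift Hk g Hg) as [l <-].
        exists (w ∘ l). rewrite <- Th. crw W2. reflexivity. }
  destruct (nmc _ _ _ iX t) as (W0 & g & Hg); [now exists KS, p2 | now exists A, (r1 ∘ q1) |].
  destruct (product_exists fc W0 A) as (D & d1 & d2 & HD).
  destruct (product_lift HD g (r1 ∘ q1)) as (g' & G1 & G2).
  assert (Hg0 : is_zero_map (g' ∘ (t ∘ iX))).
  { destruct (zero_exists ptd KR D) as [z Hz]. replace (g' ∘ (t ∘ iX)) with z; [exact Hz |].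
    apply (product_ext HD); [crw G1 | crw G2, T1]; both_zero. }
  (* A triple [(a, a, c)] killed by [g'] has [a] zero and the form [(0, x, x)]; hence [x] and [c]
     vanish. *)
  assert (Hm : is_mono (g' ∘ v)).
  { apply mono_of_zero_kernel. intros W h Hh.
    assert (H1 : is_zero_map (d2 ∘ (g' ∘ (v ∘ h)))) by (rewrite (comp_assoc _ _ _ _ _ g'); now apply zero_post).
    rewrite (comp_tail G2) in H1. revert H1. crw V1, R1. intros H1.
    destruct (kernel_lift Hg (v ∘ h)) as [l Hl].
    { rewrite <- G1. norm. rewrite (comp_assoc _ _ _ _ _ g'). now apply zero_post. }
    assert (Hl0 : is_zero_map l).
    { apply (zero_of_mono ptd (kernel_mono HkR)).
      replace (kR ∘ l) with (q1 ∘ (t ∘ iX ∘ l)).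
      - rewrite Hl. crw V1. zero.
      - crw T1, P1X. reflexivity. }
    rewrite <- (id_left _ _ _ h), <- V2. norm. rewrite <- Hl. zero. }
  assert (Ev : v ∘ dS = b).
  { apply (pullback_ext HQ); [crw V1, S1 | crw V2]; easy. }
  assert (Eb : r1 ∘ q1 ∘ b = idm A) by (now crw B1).
  (* Modulo the image of [iX], a kernel element [t (x, y)] equals [t (0, y)], which lies in the
     image of [v]; the section [b] factors through [v] as well. *)
  destruct (factor_on_point g' (g' ∘ v) Eb Ht Hm) as [rho Hrho].
  - exists (kS ∘ p2). apply (jointly_epic P1X HiY).
    + crw TY, P2Y. reflexivity.
    + apply zero_unique; [zero | rewrite <- comp_assoc; exact Hg0].
  - exists dS. now crw Ev.
  (* [rho] replaces a triple by the congruent one of the form [(b, b, p)]; the connector reads off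
     [p]. *)
  - exists (s2 ∘ rho). intros dR' dS' R1' R2' S1' S2'.
    assert (EdR : dR' = dR) by (apply jmR; congruence).
    assert (EdS : dS' = dS) by (apply jmS; congruence). subst dR' dS'. split.
    + intros u' U1' U2'.
      replace u' with u by (apply (pullback_ext HQ); congruence).
      assert (E : rho ∘ u = dS ∘ r1).
      { apply Hm. rewrite (comp_tail Hrho). crw Ev.
        apply (jointly_epic R1 HkR).
        - apply zero_unique; [| zero]. rewrite <- comp_assoc, <- TX. exact Hg0.
        - crw R1. f_equal. apply (pullback_ext HQ).
          + now crw U1, B1.
          + now crw U2, R2, B2. }
      crw E, S2. reflexivity.
    + intros v' V1' V2'.
      replace v' with v by (apply (pullback_ext HQ); congruence).
      assert (E : rho ∘ v = idm S).
      { apply Hm. rewrite (comp_tail Hrho). now rewrite id_right. }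
      crw E. reflexivity.
Qed.

(** * Regular covers, images of normal subobjects, joins, and (NH) *)

Lemma regular_epi_right_cancel {A Q W : C} (q : Hom A Q) (u v : Hom Q W) :
  is_regular_epi q -> u ∘ q = v ∘ q -> u = v.
Proof.
  intros (R & f & g & E & H) Euv.
  destruct (H W (u ∘ q)) as (w & _ & Hw).
  - now rewrite <- !comp_assoc, E.
  - rewrite (Hw u eq_refl). symmetry. now apply Hw.
Qed.

(** Regular epimorphisms are orthogonal to monomorphisms, so membership in a subobject can be tested
    on a cover. *)
Lemma factors_of_regular_cover {W' W H I : C} (p : Hom W' W) (m : Hom H I) (h : Hom W I) :
  is_regular_epi p -> is_mono m -> factors_through (h ∘ p) m -> factors_through h m.
Proof.
  intros Hp Hm [l Hl]. destruct Hp as (R & f & g & E & HU).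
  destruct (HU H l) as (l' & Hl' & _).
  - apply Hm. now rewrite !comp_assoc, Hl, <- !comp_assoc, E.
  - exists l'. apply (regular_epi_right_cancel p).
    + now exists R, f, g.
    + now rewrite <- comp_assoc, Hl'.
Qed.

(** Pullback stability: a generalised element of [I] lifts along [q] after passing to a cover. *)
Lemma regular_epi_cover {A I W : C} (q : Hom A I) (h : Hom W I) :
  is_regular_epi q ->
  exists (W' : C) (p : Hom W' W) (a : Hom W' A), is_regular_epi p /\ q ∘ a = h ∘ p.
Proof.
  intros Hq. destruct (proj2 fc _ _ _ h q) as (P & p & a & HP).
  exists P, p, a. split; [| symmetry; apply HP].
  exact (proj2 (proj2 (proj1 ex)) _ _ _ _ _ _ _ _ HP Hq).
Qed.

Lemma relation_image {R X Y : C} (f : Hom R X) (g : Hom R Y) :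
  exists (T : C) (w : Hom R T) (t1 : Hom T X) (t2 : Hom T Y),
    is_regular_epi w /\ t1 ∘ w = f /\ t2 ∘ w = g /\
    forall W (u v : Hom W T), t1 ∘ u = t1 ∘ v -> t2 ∘ u = t2 ∘ v -> u = v.
Proof.
  destruct (product_exists fc X Y) as (D & d1 & d2 & HD).
  destruct (product_lift HD f g) as (x & X1 & X2).
  destruct (proj1 (proj2 (proj1 ex)) _ _ x) as (T & w & n & Hw & Hn & E).
  exists T, w, (d1 ∘ n), (d2 ∘ n). repeat split.
  - exact Hw.
  - now rewrite <- comp_assoc, <- E.
  - now rewrite <- comp_assoc, <- E.
  - intros W u v E1 E2. apply Hn, (product_ext HD); now rewrite !comp_assoc.
Qed.

(* The image of the kernel pair of [f] along [q] is a reflexive relation, hence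
   effective; by difunctionality its normalisation is the image of [K]. *)
Lemma regular_image_normal {K A H I : C} (k : Hom K A) (q : Hom A I)
    (e : Hom K H) (m : Hom H I) :
  is_normal_mono k -> is_regular_epi q -> is_regular_epi e -> is_mono m ->
  q ∘ k = m ∘ e -> is_normal_mono m.
Proof.
  intros (B & f & Hk) Hq He Hm E.
  destruct (proj2 fc _ _ _ f f) as (R & r1 & r2 & HR).
  destruct (pullback_lift HR (idm A) (idm A) eq_refl) as (d & D1 & D2).
  destruct (relation_image (q ∘ r1) (q ∘ r2)) as (T & w & t1 & t2 & Hw & T1 & T2 & jmT).
  assert (Hd : exists d' : Hom I T, d' ∘ q = w ∘ d).
  { destruct Hq as (V & x & y & Exy & HU).
    destruct (HU T (w ∘ d)) as (d' & Hd' & _).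
    - apply jmT.
      + crw T1, D1. crw T1, D1. exact Exy.
      + crw T2, D2. crw T2, D2. exact Exy.
    - now exists d'. }
  destruct Hd as [d' Hd'].
  assert (HT : is_equivalence_relation t1 t2).
  { apply (reflexive_relation_equivalence t1 t2 d' jmT);
      apply (regular_epi_right_cancel q _ _ Hq).
    - crw Hd', T1, D1. reflexivity.
    - crw Hd', T2, D2. reflexivity. }
  destruct (proj2 ex _ _ _ _ HT) as (Z & g & Hg).
  (* [J] relates [a] to [q a'] whenever [f] identifies [a] and [a']. *)
  destruct (relation_image r1 (q ∘ r2)) as (J & j & j1 & j2 & Hj & J1 & J2 & jmJ).
  exists Z, g. apply kernel_intro; [exact Hm | |].
  - destruct (zero_exists ptd K A) as [z Hz].
    destruct (pullback_lift HR z k) as (x & X1 & X2).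
    { apply zero_unique; [zero | apply Hk]. }
    destruct (zero_exists ptd H Z) as [o Ho]. replace (g ∘ m) with o; [exact Ho |].
    apply (regular_epi_right_cancel e _ _ He). crw (eq_sym E), (eq_sym X2).
    rewrite (comp_tail (eq_sym T2)). norm. rewrite (comp_tail (eq_sym (proj1 Hg))). norm.
    crw T1, X1. both_zero.
  - intros W h Hh. destruct (zero_exists ptd W I) as [z Hz].
    destruct (pullback_lift Hg z h) as (tau & Tau1 & Tau2).
    { apply zero_unique; [zero | exact Hh]. }
    destruct (regular_epi_cover w tau Hw) as (W1 & p & rho & Hp & Erho).
    destruct (zero_exists ptd W1 A) as [o Ho].
    (* On a cover, [(0, h)] in [T] lifts to [(a, a')] in [R] with [q a] zero. From [(0, 0)],
       [(a, 0)] and [(a, h)] in [J] one gets [(0, h)], so [h] is locally the image of an element of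
       the kernel of [f]. *)
    destruct (difunctional jmJ (j ∘ (d ∘ o)) (j ∘ (d ∘ (r1 ∘ rho))) (j ∘ rho))
      as (c & C1 & C2).
    { crw J2, D2. crw J2, D2. apply zero_unique; [zero |].
      rewrite (comp_tail (eq_sym T1)). norm. crw Erho, Tau1. zero. }
    { crw J1, D1. crw J1. reflexivity. }
    destruct (regular_epi_cover j c Hj) as (W2 & p' & rho' & Hp' & Erho').
    apply (factors_of_regular_cover p m h Hp Hm).
    apply (factors_of_regular_cover p' m _ Hp' Hm).
    destruct (kernel_lift Hk (r2 ∘ rho')) as [l Hl].
    + rewrite comp_assoc, <- (proj1 HR), <- J1. norm. crw Erho', C1. crw J1, D1. zero.
    + exists (e ∘ l). crw (eq_sym E), Hl.
      rewrite (comp_tail (eq_sym J2)). crw Erho', C2. crw J2.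
      rewrite (comp_tail (eq_sym T2)). crw Erho, Tau2. reflexivity.
Qed.

(** Divide by [X] through [f]: the image of [Y] is normal, say the kernel of [g], and [J] is the
    kernel of [g ∘ f]. Indeed an element killed by [g ∘ f] is locally congruent modulo [f] to one of
    [Y]. *)
Lemma join_of_normal_is_normal {S X Y A J : C} (i1 : Hom X S) (i2 : Hom Y S)
    (q : Hom S J) (j : Hom J A) :
  is_coproduct i1 i2 -> is_regular_epi q -> is_mono j ->
  is_normal_mono (j ∘ q ∘ i1) -> is_normal_mono (j ∘ q ∘ i2) -> is_normal_mono j.
Proof.
  intros HS Hq Hj (B0 & f0 & Hx) Hy.
  (* Passing to the image of [f0] keeps the kernel and makes [f] a regular epimorphism, as
     [regular_image_normal] requires. *)
  destruct (proj1 (proj2 (proj1 ex)) _ _ f0) as (B & f & n0 & Hf & Hn0 & Ef0).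
  assert (Hxf : is_kernel (j ∘ q ∘ i1) f).
  { apply kernel_intro.
    - apply (kernel_mono Hx).
    - apply (zero_of_mono ptd Hn0). rewrite comp_assoc, <- Ef0. apply Hx.
    - intros W h Hh. apply (kernel_lift Hx). rewrite Ef0. zero. }
  destruct (proj1 (proj2 (proj1 ex)) _ _ (f ∘ (j ∘ q ∘ i2))) as (N & e & n & He & Hn & En).
  destruct (regular_image_normal _ f e n Hy Hf He Hn En) as (Z & g & Hg).
  exists Z, (g ∘ f). apply kernel_intro; [exact Hj | |].
  - destruct (zero_exists ptd J Z) as [o Ho]. replace (g ∘ f ∘ j) with o; [exact Ho |].
    apply (regular_epi_right_cancel q _ _ Hq).
    destruct (HS Z (o ∘ q ∘ i1) (o ∘ q ∘ i2)) as (w & _ & Hw).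
    rewrite (Hw (o ∘ q)) by easy. symmetry. apply Hw; (apply zero_unique; [| zero]).
    + norm. apply zero_post. rewrite (comp_assoc _ _ _ _ _ j). apply Hxf.
    + norm. rewrite (comp_assoc _ _ _ _ _ j), En, comp_assoc. apply zero_pre, Hg.
  - intros W h Hh.
    destruct (kernel_lift Hg (f ∘ h)) as [l Hl]; [now rewrite comp_assoc |].
    destruct (regular_epi_cover e l He) as (W' & p & y & Hp & Ey).
    apply (factors_of_regular_cover p j h Hp Hj).
    (* J contains the kernel of f, so it is closed under congruence modulo f. *)
    destruct (proj2 fc _ _ _ f (f ∘ j)) as (D & d1 & d2 & HD).
    destruct (pullback_lift HD j (idm J)) as (s & S1 & S2); [now rewrite id_right |].
    destruct (kernel_exists d2) as (K & k & Hk).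
    destruct (factor_on_point d1 j S2 Hk Hj) as [z Hz].
    + destruct (kernel_lift Hxf (d1 ∘ k)) as [a Ha].
      * rewrite comp_assoc, (proj1 HD). zero.
      * exists (q ∘ i1 ∘ a). rewrite <- Ha. now norm.
    + exists (idm J). now rewrite S1, id_right.
    + destruct (pullback_lift HD (h ∘ p) (q ∘ i2 ∘ y)) as (c & C1 & _).
      * rewrite comp_assoc, <- Hl. crw (eq_sym Ey), (eq_sym En). now norm.
      * exists (z ∘ c). rewrite comp_assoc, Hz. exact C1.
Qed.

(* [[X, Y]] is always normal in the join of [X] and [Y], being the image of a
   normal subobject of [X + Y]; the join is normal because [X] and [Y] are. *)
Lemma normal_monos_compose_NH : NH C.
Proof.
  intros X Y A H x y m Hx Hy
    (S & P & K & i1 & i2 & p1 & p2 & sigma & kappa & c & e &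
     HS & _ & _ & _ & _ & _ & Hkappa & C1 & C2 & He & Hm & E).
  (* The image [J] of [c] is the join of [X] and [Y]. *)
  destruct (proj1 (proj2 (proj1 ex)) _ _ c) as (J & q & j & Hq & Hj & ->).
  destruct (factors_of_regular_cover e j m He Hj) as [m' <-].
  { exists (q ∘ kappa). now rewrite comp_assoc. }
  apply nmc.
  - apply (regular_image_normal kappa q e m'); try assumption.
    + now exists P, sigma.
    + exact (mono_of_comp _ _ Hm).
    + apply Hj. now rewrite !comp_assoc.
  - apply (join_of_normal_is_normal i1 i2 q j); try assumption; congruence.
Qed.

End SemiAbelian.

Theorem mainTheorem14 (C : Category) :
  semi_abelian C -> normal_monos_compose C ->
  kernel_functors_preserve_normal_closures C /\ strongly_protomodular C /\
  SH C /\ NH C.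
Proof.
  intros (ptd & ex & pm & _) nmc. assert (fc : finitely_complete C) by apply ex.
  split; [| split; [| split]].
  - now apply preservation_of_normal_closures.
  - now apply strong_protomodularity.
  - now apply normal_monos_compose_SH.
  - now apply normal_monos_compose_NH.
Qed.
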